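(* Let $\Theta$ be an $M_N(\mathbb{C})$-valued measure of the form $\Theta(X)=\int_X W(x)\,d\mu(x)$, $X\in\mathscr{B}$, where $\mu$ is a nonzero $\sigma$-finite positive Borel measure on $\mathbb{R}$ and $W\colon\mathbb{R}\to M_N(\mathbb{C})$ is $\mu$-integrable and strictly positive definite $\mu$-almost everywhere. Let $\mathscr{A}=\{T\in M_N(\mathbb{C}) : T\Theta(X)=\Theta(X)T^*\ \forall X\in\mathscr{B}\}$ and let $A_h$ be the set of Hermitian matrices in the commutant algebra $A=\{T\in M_N(\mathbb{C}) : T\Theta(X)=\Theta(X)T\ \forall X\in\mathscr{B}\}$. Then $\mathscr{A}$ is $*$-invariant if and only if $\mathscr{A}=A_h$.
   Context: $N\ge 1$; $M_N(\mathbb{C})$ is the algebra of $N\times N$ complex matrices; $\mathscr{B}$ is the $\sigma$-algebra of Borel subsets of $\mathbb{R}$; $T^*$ denotes the adjoint (conjugate transpose) of $T$. $\mathscr{A}$ and $A_h$ are real vector spaces. The set $\mathscr{A}$ is called $*$-invariant if $T\in\mathscr{A}$ implies $T^*\in\mathscr{A}$. *)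

(* Defs.v *)
From HB Require Import structures.
From mathcomp Require Import all_boot all_order all_algebra.
From mathcomp Require Import all_classical all_reals all_analysis.
From mathcomp.real_closed Require Import complex.

Set Implicit Arguments.
Unset Strict Implicit.
Unset Printing Implicit Defensive.

Import Order.TTheory GRing.Theory Num.Theory.
Import numFieldNormedType.Exports.

Local Open Scope classical_set_scope.
Local Open Scope ring_scope.
Local Open Scope sesquilinear_scope.

Definition posdefmx (C : numClosedFieldType) (n : nat) (M : 'M[C]_n) : Prop :=
  M \is hermsymmx /\
  forall v : 'cV[C]_n, v != 0 -> 0 < (v ^t* *m M *m v) 0 0.

(* Matrix-valued functions are integrated entrywise, and complex-valued ones   *)
(* through their real and imaginary parts.                                     *)
Definition mx_integrable (d : measure_display) (X : measurableType d)
    (R : realType) (mu : {measure set X -> \bar R}) (m n : nat) (D : set X)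
    (W : X -> 'M[R[i]]_(m, n)) : Prop :=
  forall i j, mu.-integrable D (fun x => (complex.Re (W x i j))%:E) /\
              mu.-integrable D (fun x => (complex.Im (W x i j))%:E).

Definition mx_integral (d : measure_display) (X : measurableType d)
    (R : realType) (mu : {measure set X -> \bar R}) (m n : nat) (D : set X)
    (W : X -> 'M[R[i]]_(m, n)) : 'M[R[i]]_(m, n) :=
  \matrix_(i < m, j < n)
    Complex (\int[mu]_(x in D) complex.Re (W x i j))
            (\int[mu]_(x in D) complex.Im (W x i j)).

Section MatrixValuedMeasure.
Context (d : measure_display) (X : measurableType d).
Context (C : numClosedFieldType) (N : nat).
Implicit Types (Theta : set X -> 'M[C]_N) (S : set 'M[C]_N).

(* The script letter A of the text, as opposed to the commutant algebra A.     *)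
Definition calA Theta : set 'M[C]_N :=
  [set T | forall B, measurable B -> T *m Theta B = Theta B *m T ^t*].

Definition commutant Theta : set 'M[C]_N :=
  [set T | forall B, measurable B -> T *m Theta B = Theta B *m T].

Definition commutant_herm Theta : set 'M[C]_N :=
  [set T | commutant Theta T /\ T \is hermsymmx].

Definition star_invariant S : Prop := forall T, S T -> S (T ^t*).

End MatrixValuedMeasure.

(* Main.v *)
(* With [S := Theta R], positive definiteness of [W] almost everywhere and     *)
(* [mu <> 0] give [Re (v^* S v) > 0] for every [v <> 0]. If [T] and [T^*] both  *)
(* lie in the script A, then [K := T - T^*] satisfies [K^* = - K] and           *)
(* [K S = - S K], so that [tr (K^* S K) = 0] and hence [K = 0]; a Hermitian     *)
(* element of the script A is the same thing as one of the commutant.          *)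
Require Import Defs.
From HB Require Import structures.
From mathcomp Require Import all_boot all_order all_algebra.
From mathcomp Require Import all_classical all_reals all_analysis.
From mathcomp Require Import measurable_realfun.
From mathcomp.real_closed Require Import complex.

Set Implicit Arguments.
Unset Strict Implicit.
Unset Printing Implicit Defensive.

Import Order.TTheory GRing.Theory Num.Theory.
Import numFieldNormedType.Exports.

Local Open Scope classical_set_scope.
Local Open Scope ring_scope.
Local Open Scope sesquilinear_scope.

(** Star-invariance puts [T] and [T ^t*] in [calA] together, and testing both relations on the whole
    line already forces [T ^t* = T] ([selfadjoint_of_intertwining]). The analytic input is
    [Re_quad_integral_gt0]: the real part of the quadratic form of the integral of [W] is the
    integral of those of the [W x], which are positive almost everywhere on a space of nonzero
    measure. For Hermitian [T] the relations defining [calA] and [commutant] coincide, and a set of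
    Hermitian matrices is stable under the adjoint. *)

Lemma integrable_EFin_sum (d : measure_display) (X : measurableType d)
    (R : realType) (mu : {measure set X -> \bar R}) (D : set X) (I : Type)
    (s : seq I) (f : I -> X -> R) (mD : measurable D)
    (hf : forall i, mu.-integrable D (EFin \o f i)) :
  mu.-integrable D (fun x => (\sum_(i <- s) f i x)%:E).
Proof.
under eq_fun do rewrite -sumEFin.
by apply: integrable_sum => // i _; exact: hf.
Qed.

Lemma Rintegral_sum (d : measure_display) (X : measurableType d)
    (R : realType) (mu : {measure set X -> \bar R}) (D : set X) (I : Type)
    (s : seq I) (f : I -> X -> R) (mD : measurable D)
    (hf : forall i, mu.-integrable D (EFin \o f i)) :
  \int[mu]_(x in D) (\sum_(i <- s) f i x) =
  \sum_(i <- s) \int[mu]_(x in D) f i x.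
Proof.
elim: s => [|i s IHs].
  rewrite big_nil; under eq_Rintegral do rewrite big_nil.
  by rewrite Rintegral_cst// mul0r.
rewrite big_cons -IHs; under eq_Rintegral do rewrite big_cons.
by rewrite RintegralD//; exact: integrable_EFin_sum.
Qed.

(** If the integral were zero, [f] would vanish almost everywhere while being positive almost
    everywhere, so a null set would cover the whole space, against [mu0]. *)
Lemma Rintegral_gt0 (d : measure_display) (X : measurableType d)
    (R : realType) (mu : {measure set X -> \bar R}) (f : X -> R)
    (mu0 : mu setT <> 0%E) (hf : mu.-integrable setT (EFin \o f))
    (f_gt0 : {ae mu, forall x, 0 < f x}) :
  0 < \int[mu]_(x in setT) f x.
Proof.
have mf := measurable_int mu hf.
have abs_eq : (\int[mu]_(x in setT) (f x)%:E =
               \int[mu]_(x in setT) `|(f x)%:E|)%E.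
  apply: ae_eq_integral => //; first exact: measurableT_comp.
  by apply: filterS f_gt0 => x fx _ /=; rewrite ger0_norm// ltW.
(* The real integral is [fine] of an extended one; integrability makes the latter finite, so the
   sign can be read in the extended reals. *)
rewrite lt_neqAle -lee_fin -[X in _ && (_ <= X)%E]/((fine _)%:E).
rewrite fineK ?integrable_fin_num// abs_eq integral_ge0// andbT.
apply/eqP => int0; apply: mu0.
have /ae_eq_integral_abs : (\int[mu]_(x in setT) `|(f x)%:E| = 0)%E.
  by rewrite -abs_eq -[LHS]fineK ?integrable_fin_num// -[fine _]int0.
move=> /(_ measurableT mf) f0.
have : {ae mu, forall x : X, False}.
  by apply: filterS2 f_gt0 f0 => x fx /(_ I) [fx0]; rewrite fx0 ltxx in fx.
case=> A [mA A0 subA]; rewrite (_ : setT = A)//.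
by apply/seteqP; split => // x _; apply: subA.
Qed.

Section ComplexRe.
Variable R : rcfType.
Implicit Types x y : R[i].

Lemma ReD x y : complex.Re (x + y) = complex.Re x + complex.Re y.
Proof. by case: x; case: y. Qed.

Lemma ReM x y :
  complex.Re (x * y) = complex.Re x * complex.Re y - complex.Im x * complex.Im y.
Proof. by case: x; case: y. Qed.

Lemma Re_sum (I : Type) (s : seq I) (f : I -> R[i]) :
  complex.Re (\sum_(i <- s) f i) = \sum_(i <- s) complex.Re (f i).
Proof. exact: (big_morph _ ReD). Qed.

Lemma Re_mxtrace_mul m n (A : 'M[R[i]]_(m, n)) (B : 'M[R[i]]_(n, m)) :
  complex.Re (\tr (A *m B)) =
  \sum_i \sum_j (complex.Re (A i j) * complex.Re (B j i)
                 - complex.Im (A i j) * complex.Im (B j i)).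
Proof.
rewrite Re_sum; apply: eq_bigr => i _; rewrite mxE Re_sum.
by apply: eq_bigr => j _; rewrite ReM.
Qed.

End ComplexRe.

Section TraceIntegral.
Context (d : measure_display) (X : measurableType d) (R : realType).
Context (mu : {measure set X -> \bar R}) (D : set X) (m n : nat).
Context (A : 'M[R[i]]_(m, n)) (W : X -> 'M[R[i]]_(n, m)).
Hypotheses (mD : measurable D) (hW : mx_integrable mu D W).

Let integrable_entry i j : mu.-integrable D
  (EFin \o fun x => complex.Re (A i j) * complex.Re (W x j i)
                    - complex.Im (A i j) * complex.Im (W x j i)).
Proof.
have [hRe hIm] := hW j i.
exact: (integrableB mD (integrableZl mD _ hRe) (integrableZl mD _ hIm)).
Qed.

Lemma integrable_Re_mxtrace_mul :
  mu.-integrable D (fun x => (complex.Re (\tr (A *m W x)))%:E).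
Proof.
under eq_fun do rewrite Re_mxtrace_mul.
do 2![apply: integrable_EFin_sum => // ?]; exact: integrable_entry.
Qed.

(** The real part of a trace against a fixed matrix is a finite real combination of the real and
    imaginary parts of entries, so it commutes with the entrywise integral. *)
Lemma Re_mxtrace_mul_integral :
  complex.Re (\tr (A *m mx_integral mu D W)) =
  \int[mu]_(x in D) complex.Re (\tr (A *m W x)).
Proof.
under eq_Rintegral do rewrite Re_mxtrace_mul.
rewrite Re_mxtrace_mul Rintegral_sum// => [|i]; last first.
  by apply: integrable_EFin_sum => // j; exact: integrable_entry.
apply: eq_bigr => i _; rewrite Rintegral_sum//; apply: eq_bigr => j _.
have [hRe hIm] := hW j i.
rewrite !mxE/= RintegralB ?RintegralZl//.
  exact: (integrableZl mD _ hRe).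
exact: (integrableZl mD _ hIm).
Qed.

End TraceIntegral.

Lemma Re_quad_integral_gt0 (d : measure_display) (X : measurableType d)
    (R : realType) (mu : {measure set X -> \bar R}) (n : nat)
    (W : X -> 'M[R[i]]_n) (v : 'cV[R[i]]_n) (mu0 : mu setT <> 0%E)
    (hW : mx_integrable mu setT W) (hWpos : {ae mu, forall x, posdefmx (W x)}) :
  v != 0 -> 0 < complex.Re ((v ^t* *m mx_integral mu setT W *m v) 0 0).
Proof.
move=> v0.
(* By cyclicity the quadratic form is a trace against the rank-one matrix [v *m v ^t*], hence linear
   in [M] in the form needed to integrate it. *)
have quadE (M : 'M[R[i]]_n) : (v ^t* *m M *m v) 0 0 = \tr (v *m v ^t* *m M).
  by rewrite -trace_mx11 mxtrace_mulC mulmxA.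
rewrite quadE Re_mxtrace_mul_integral//.
apply: Rintegral_gt0 => //; first exact: integrable_Re_mxtrace_mul.
apply: filterS hWpos => x [_ /(_ v v0)].
by rewrite quadE ltcE => /andP[_].
Qed.

(** The trace is the sum of the quadratic forms of [P] at the columns of [K], and a nonzero [K] has
    a nonzero column. *)
Lemma Re_mxtrace_conj_gt0 (R : rcfType) (m n : nat) (P : 'M[R[i]]_m)
    (hP : forall v : 'cV_m, v != 0 -> 0 < complex.Re ((v ^t* *m P *m v) 0 0))
    (K : 'M[R[i]]_(m, n)) :
  K != 0 -> 0 < complex.Re (\tr (K ^t* *m P *m K)).
Proof.
have trE : \tr (K ^t* *m P *m K) =
    \sum_j ((col j K) ^t* *m P *m col j K) 0 0.
  apply: eq_bigr => j _; rewrite !mxE; apply: eq_bigr => k _.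
  by rewrite !mxE; congr (_ * _); apply: eq_bigr => l _; rewrite !mxE.
have ge0 j : 0 <= complex.Re (((col j K) ^t* *m P *m col j K) 0 0).
  have [->|/hP/ltW//] := eqVneq (col j K) 0.
  by rewrite mulmx0 mxE.
move=> K0; have [j Kj] : exists j, col j K != 0.
  apply/existsP; apply: contraNT K0; rewrite negb_exists => /forallP K0.
  apply/eqP/matrixP => i j; have /negPn/eqP/colP/(_ i) := K0 j.
  by rewrite !mxE.
rewrite trE Re_sum (bigD1 j)//= ltr_pwDl ?hP//.
exact: sumr_ge0.
Qed.

Lemma selfadjoint_of_intertwining (R : rcfType) (n : nat) (P T : 'M[R[i]]_n)
    (hP : forall v : 'cV_n, v != 0 -> 0 < complex.Re ((v ^t* *m P *m v) 0 0))
    (TP : T *m P = P *m T ^t*) (TsP : T ^t* *m P = P *m T) :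
  T ^t* = T.
Proof.
pose K := T - T ^t*.
have Kadj : K ^t* = - K by rewrite /K linearB/= map_mxB trmxCK opprB.
have KP : K *m P = - (P *m K) by rewrite mulmxBl mulmxBr TP TsP opprB.
(* Since [K] is skew-adjoint, the trace is that of [K *m P *m K] up to sign; moving the left [K]
   past [P] costs a sign, and cyclicity restores the product. *)
have trN : \tr (K ^t* *m P *m K) = - \tr (K ^t* *m P *m K).
  rewrite Kadj !mulNmx linearN/=; congr (- _).
  by rewrite {1}KP mulNmx linearN/= mxtrace_mulC mulmxA.
have tr0 : complex.Re (\tr (K ^t* *m P *m K)) = 0.
  by move: trN; case: (\tr _) => a b [] /= /eqP; rewrite -addr_eq0 -mulr2n mulrn_eq0 => /eqP.
have [/eqP|/(Re_mxtrace_conj_gt0 hP)] := eqVneq K 0; last by rewrite tr0 ltxx.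
by rewrite subr_eq0 => /eqP.
Qed.

Theorem corollary2p5 (R : realType) (N : nat) (hN : (1 <= N)%N)
    (mu : {sigma_finite_measure set (measurableTypeR R) -> \bar R})
    (hmu : exists2 B : set (measurableTypeR R), measurable B & mu B <> 0%E)
    (W : measurableTypeR R -> 'M[R[i]]_N)
    (hW : mx_integrable mu setT W)
    (hWpos : {ae mu, forall x, posdefmx (W x)})
    (Theta : set (measurableTypeR R) -> 'M[R[i]]_N)
    (hTheta : forall B, measurable B -> Theta B = mx_integral mu B W) :
  star_invariant (calA Theta) <-> calA Theta = commutant_herm Theta.
Proof.
have mu0 : mu setT <> 0%E.
  case: hmu => B mB muB muT; apply: muB; apply/eqP.
  by rewrite -measure_le0 -muT le_measure ?inE.
have hermP (T : 'M[R[i]]_N) : T \is hermsymmx <-> T ^t* = T.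
  split=> [/is_hermitianmxP|TT]; first by rewrite expr0 scale1r => <-.
  by apply/is_hermitianmxP; rewrite expr0 scale1r TT.
split=> [starA|-> T [cT hT]]; last first.
  by move/hermP: (hT) => ->.
apply/seteqP; split=> T.
  move=> AT; suff TT : T ^t* = T.
    by split; [move=> B mB; rewrite AT// TT|exact/hermP].
  (* Both relations are used at [setT], with [Theta setT] as the positive matrix [P]. *)
  have posS v := @Re_quad_integral_gt0 _ _ _ _ _ _ v mu0 hW hWpos.
  apply: (selfadjoint_of_intertwining posS); rewrite -hTheta//.
    exact: AT.
  by rewrite starA// trmxCK.
by move=> [cT /hermP TT] B mB; rewrite TT cT.
Qed.
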